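(* Let $\mathbf{C}\in\mathcal{S}^n$, $\mathbf{b}\in\mathbb{R}^m$, $\varepsilon>0$, let $\mathcal{A}:\mathcal{S}^n\to\mathbb{R}^m$ be a linear map with adjoint $\mathcal{A}^*:\mathbb{R}^m\to\mathcal{S}^n$, and let $\Omega:=\{X\in\mathcal{S}^n:\mathcal{A}(X)=\mathbf{b},\ X\succeq0\}$. Assume that $\Omega$ is compact and that: (1) Slater's condition holds, i.e., there exists $X_0\in\Omega$ with $X_0\succ0$; (2) for $\lambda\in\mathbb{R}^m$, $\mathcal{A}^*\lambda=0$ implies $\lambda=0$. Then $G_\varepsilon(\lambda)\to-\infty$ whenever $\Vert\lambda\Vert\to+\infty$, where $$G_\varepsilon(\lambda):=\mathbf{b}^T\lambda+\inf_{X}\{\mathrm{Tr}(X\cdot(\mathbf{C}-\mathcal{A}^*\lambda))+\varepsilon\,\mathrm{Tr}(X\cdot\ln(X))\},\qquad\lambda\in\mathbb{R}^m,$$ the infimum being over $X\in\mathcal{S}^n$ with $X\succeq0$.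
   Context: $\mathcal{S}^n$ is the space of real symmetric $n\times n$ matrices with inner product $\langle X,Y\rangle=\mathrm{Tr}(X\cdot Y)$; $\mathbb{R}^m$ carries the standard inner product and Euclidean norm $\Vert\cdot\Vert$, and $\mathcal{A}^*$ is the adjoint of $\mathcal{A}$ for these inner products. For $X\succeq0$ with eigenvalues $\sigma_1,\ldots,\sigma_n$, $\mathrm{Tr}(X\cdot\ln(X)):=\sum_{i=1}^n\sigma_i\ln(\sigma_i)$ with the convention $0\ln 0=0$. *)

(* Defs.v *)
From HB Require Import structures.
From mathcomp Require Import all_boot all_order all_algebra spectral sesquilinear.
From mathcomp Require Import complex.
From mathcomp Require Import all_classical all_reals all_analysis.

Set Implicit Arguments.
Unset Strict Implicit.
Unset Printing Implicit Defensive.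

Import Order.TTheory GRing.Theory Num.Theory.
Import numFieldNormedType.Exports.

Local Open Scope classical_set_scope.
Local Open Scope ring_scope.

Section SymmetricMatrices.
Variables (R : realType) (n : nat).

Definition is_symm : {pred 'M[R]_n} := [pred X | X^T == X].

Fact is_symm_submod_closed : submod_closed is_symm.
Proof.
split=> [|a X Y]; first by rewrite inE trmx0.
by rewrite !inE => /eqP XT /eqP YT; rewrite linearP /= XT YT.
Qed.

HB.instance Definition _ :=
  GRing.isSubmodClosed.Build R 'M[R]_n is_symm is_symm_submod_closed.

Record symmx := SymMx { symmx_val :> 'M[R]_n; _ : symmx_val \in is_symm }.

HB.instance Definition _ := [isSub for symmx_val].
HB.instance Definition _ := [Choice of symmx by <:].
HB.instance Definition _ := [SubChoice_isSubZmodule of symmx by <:].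
HB.instance Definition _ := [SubZmodule_isSubLmodule of symmx by <:].
HB.instance Definition _ :=
  Topological.copy symmx (initial_topology symmx_val).

(* When X is nonsymmetric this is only about the symmetric part of X, hence
   the restriction to symmx. *)
Definition psd (X : symmx) :=
  forall v : 'cV[R]_n, 0 <= (v^T *m X *m v) 0 0.

Definition posdef (X : symmx) :=
  forall v : 'cV[R]_n, v != 0 -> 0 < (v^T *m X *m v) 0 0.

(* The eigenvalues repeated according to multiplicity, in an unspecified order;
   symmx_eigenvaluesP shows that the default value 0 is never used. *)
Definition symmx_eigenvalues (X : symmx) : 'rV[R]_n :=
  xget 0 [set s : 'rV[R]_n | char_poly X = \prod_(i < n) ('X - (s 0 i)%:P)].

(* Tr(X . ln X); here [ln] is a total function, and 0 * ln 0 = 0 whatever the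
   value of ln 0. *)
Definition tr_xlnx (X : symmx) : R :=
  \sum_(i < n) symmx_eigenvalues X 0 i * ln (symmx_eigenvalues X 0 i).

Definition symmx_inner (X Y : symmx) : R := \tr (X *m Y).

End SymmetricMatrices.

Lemma symmx_eigenvaluesP (R : realType) (n : nat) (X : symmx R n) :
  char_poly X = \prod_(i < n) ('X - (symmx_eigenvalues X 0 i)%:P).
Proof.
rewrite /symmx_eigenvalues; case: xgetP => [s _ //|nex]; exfalso.
pose f := real_complex R.
have Xs : map_mx f X \is symmetricmx.
  rewrite is_hermitianmxE expr0 scale1r; apply/eqP/matrixP => i j.
  by rewrite !mxE; have /eqP/matrixP/(_ i j) := valP X; rewrite mxE => ->.
have Xr : map_mx f X \is a realmx.
  by apply/mxOverP => i j; rewrite mxE complex_real.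
have Xh := realsym_hermsym Xs Xr.
have dr := hermitian_spectral_diag_real Xh.
have /hermitian_normalmx /orthomx_spectralP XE := Xh.
have Pu := spectral_unit (map_mx f X).
pose d : 'rV[R]_n := \row_i complex.Re (spectral_diag (map_mx f X) 0 i).
have dE : spectral_diag (map_mx f X) = map_mx f d.
  apply/rowP => i; rewrite !mxE /f.
  by apply/esym/RRe_real; move/mxOverP: dr; apply.
apply: (nex d) => /=; apply: (map_poly_inj f).
rewrite map_char_poly rmorph_prod /= XE dE.
set P := spectralmx _ in Pu *.
have -> : char_poly (invmx P *m diag_mx (map_mx f d) *m P) =
          char_poly (diag_mx (map_mx f d)).
  rewrite /char_poly /char_poly_mx !map_mxM.
  have -> : 'X%:M - map_mx polyC (invmx P) *m map_mx polyC (diag_mx (map_mx f d))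
      *m map_mx polyC P = map_mx polyC (invmx P) *m
      ('X%:M - map_mx polyC (diag_mx (map_mx f d))) *m map_mx polyC P.
    rewrite mulmxBr mulmxBl; congr (_ - _).
    by rewrite scalar_mxC -mulmxA -map_mxM mulVmx // map_mx1 mulmx1.
  rewrite !det_mulmx mulrAC -det_mulmx -map_mxM mulVmx //.
  by rewrite map_mx1 det1 mul1r.
rewrite char_poly_trig ?diag_mx_is_trig //.
apply: eq_bigr => i _; rewrite rmorphB /= map_polyX map_polyC /=.
by rewrite !mxE eqxx mulr1n.
Qed.

Section EuclideanSpace.
Variables (R : realType) (m : nat).

Definition dotv (u v : 'cV[R]_m) : R := (u^T *m v) 0 0.

(* The library norm on matrices is the sup norm. *)
Definition enorm (u : 'cV[R]_m) : R := Num.sqrt (dotv u u).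

End EuclideanSpace.

Section SemidefiniteProgram.
Variables (R : realType) (n m : nat).

Definition is_adjoint (A : symmx R n -> 'cV[R]_m)
    (Aadj : 'cV[R]_m -> symmx R n) :=
  forall X l, dotv (A X) l = symmx_inner X (Aadj l).

Definition feasible (A : symmx R n -> 'cV[R]_m) (b : 'cV[R]_m) :
    set (symmx R n) :=
  [set X | A X = b /\ psd X].

(* The infimum is taken in the extended reals, so that no lower bound is
   presupposed. *)
Definition dual_entropic (C : symmx R n) (b : 'cV[R]_m)
    (Aadj : 'cV[R]_m -> symmx R n) (eps : R) (l : 'cV[R]_m) : \bar R :=
  ((dotv b l)%:E +
   ereal_inf [set (symmx_inner X (C - Aadj l) + eps * tr_xlnx X)%:E
             | X in [set X | psd X]])%E.

End SemidefiniteProgram.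

(* Main.v *)
(** Let X0 be the Slater point, L = A* l and N the Frobenius norm of L.  Since
    X0 is positive definite, X = X0 + t (L / N) is positive semidefinite for
    some t > 0 that does not depend on l.  As b^T l = <X0, L>, testing the
    infimum at X gives
      G l <= <X, C> + eps Tr (X ln X) - <X - X0, L> <= K - t N,
    where K bounds the first two terms uniformly because X stays bounded.
    Finally N >= c |l| for some c > 0, because A* is injective. *)

Require Import Defs.
From HB Require Import structures.
From mathcomp Require Import all_boot all_order all_algebra.
From mathcomp Require Import all_classical all_reals all_analysis.
From mathcomp Require Import ring lra.

Set Implicit Arguments.
Unset Strict Implicit.
Unset Printing Implicit Defensive.

Import Order.TTheory GRing.Theory Num.Theory.
Import numFieldNormedType.Exports.

Local Open Scope classical_set_scope.
Local Open Scope ring_scope.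

(** * Quadratic forms: compactness of the unit sphere and coercivity *)

Section QuadraticForms.
Variables (R : realType) (n : nat).
Implicit Types (M : 'M[R]_n) (v : 'cV[R]_n).

Lemma dotvE v : dotv v v = \sum_i v i 0 ^+ 2.
Proof. by rewrite /dotv mxE; apply: eq_bigr => i _; rewrite mxE expr2. Qed.

Lemma dotv_ge0 v : 0 <= dotv v v.
Proof. by rewrite dotvE; apply: sumr_ge0 => i _; exact: sqr_ge0. Qed.

Lemma dotv_eq0 v : (dotv v v == 0) = (v == 0).
Proof.
apply/eqP/eqP => [|->]; last by rewrite /dotv mulmx0 mxE.
rewrite dotvE => v0; apply/colP => i; rewrite mxE.
by apply/eqP; rewrite -sqrf_eq0; apply/eqP; apply: (psumr_eq0P _ v0) => // j _;
  exact: sqr_ge0.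
Qed.

Lemma quad_formE M v :
  (v^T *m M *m v) 0 0 = \sum_i \sum_j v i 0 * M i j * v j 0.
Proof.
rewrite mxE exchange_big /=; apply: eq_bigr => j _.
by rewrite mxE mulr_suml; apply: eq_bigr => i _; rewrite mxE.
Qed.

Lemma quad_formZ M (a : R) v :
  ((a *: v)^T *m M *m (a *: v)) 0 0 = a ^+ 2 * (v^T *m M *m v) 0 0.
Proof.
by rewrite -scalemxAr [(a *: v)^T]linearZ -!scalemxAl scalerA mxE expr2.
Qed.

Lemma continuous_quad_form M :
  continuous (fun u : 'rV[R]_n => (u *m M *m u^T) 0 0).
Proof.
move=> u; rewrite [X in continuous_at _ X](_ : _ =
  fun u : 'rV[R]_n => \sum_i \sum_j u 0 i * M i j * u 0 j); last first.
  apply/funext => w; have := quad_formE M w^T; rewrite trmxK => ->.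
  by apply: eq_bigr => i _; apply: eq_bigr => j _; rewrite !mxE.
have FF := nbhs_filter u.
apply: cvg_big => [|i _]; first exact: add_continuous.
apply: cvg_big => [|j _]; first exact: add_continuous.
by apply: cvgM; [apply: cvgM; [exact: coord_continuous|exact: cvg_cst]|
  exact: coord_continuous].
Qed.

(** Writing the sphere as a level set of the form of [1%:M] lets closedness follow from
    [continuous_quad_form]. Row vectors are used to match [EVT_min_rV]. *)
Lemma compact_unit_sphere :
  compact [set u : 'rV[R]_n | (u *m (1%:M : 'M[R]_n) *m u^T) 0 0 = 1].
Proof.
apply: bounded_closed_compact.
  exists 1; split=> // x x1 u /= u1; apply: (le_trans _ (ltW x1)).
  rewrite [`|u|]mx_normrE; apply: bigmax_le => // -[i j] _ /=; rewrite (ord1 i).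
  rewrite -(@ler_pXn2r _ 2) ?nnegrE// expr1n real_normK ?num_real//.
  have: dotv u^T u^T = 1 by rewrite /dotv trmxK -[RHS]u1 mulmx1.
  rewrite dotvE (bigD1 j) //= mxE => <-.
  by rewrite lerDl; apply: sumr_ge0 => k _; exact: sqr_ge0.
apply: (@preimage_closed _ _
  (fun u : 'rV[R]_n => (u *m 1%:M *m u^T) 0 0) [set 1]).
  by move=> u _; exact: continuous_quad_form.
exact: closed_eq.
Qed.

(** The constant is the minimum of the form on the compact unit sphere, extended to all vectors by
    homogeneity. Symmetry of [M] plays no part in this argument. *)
Lemma posdef_coercive M :
  (forall v, v != 0 -> 0 < (v^T *m M *m v) 0 0) ->
  exists2 c : R, 0 < c & forall v, c * dotv v v <= (v^T *m M *m v) 0 0.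
Proof.
move=> M_gt0.
have [c c0 cM] : exists2 c : R, 0 < c &
    forall v, dotv v v = 1 -> c <= (v^T *m M *m v) 0 0.
  have [S0|nS] := pselect ([set u : 'rV[R]_n |
      (u *m (1%:M : 'M[R]_n) *m u^T) 0 0 = 1] !=set0); last first.
    (* On an empty sphere ([n] equal to 0) any positive constant works vacuously. *)
    exists 1 => // v v1; exfalso; apply: nS; exists v^T => /=.
    by rewrite mulmx1 trmxK.
  have [u uS minu] := EVT_min_rV S0 compact_unit_sphere
    (continuous_subspaceT (@continuous_quad_form M)).
  exists ((u *m M *m u^T) 0 0).
    move: uS; rewrite inE /= => u1.
    have := M_gt0 u^T; rewrite trmxK; apply.
    apply/eqP => u0; move: u1; rewrite u0 mulmx0 mxE => /esym/eqP.
    by rewrite oner_eq0.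
  move=> v v1; have := minu v^T; rewrite trmxK; apply.
  by rewrite inE /= mulmx1 trmxK.
exists c => // v; have [->|v0] := eqVneq v 0.
  by rewrite /dotv !mulmx0 mxE mulr0.
have d0 : 0 < dotv v v by rewrite lt_def dotv_eq0 v0 dotv_ge0.
have s2 : (Num.sqrt (dotv v v))^-1 ^+ 2 = (dotv v v)^-1.
  by rewrite exprVn sqr_sqrtr // ltW.
have := cM ((Num.sqrt (dotv v v))^-1 *: v).
rewrite quad_formZ s2 ler_pdivlMl// mulrC; apply.
(* The same scaling law, for the identity matrix, shows that the rescaled vector has length 1. *)
have := quad_formZ 1%:M (Num.sqrt (dotv v v))^-1 v.
by rewrite !mulmx1 s2 /dotv => ->; rewrite mulVf // gt_eqF.
Qed.

(** Each term is at most [(v i 0 ^+ 2 + v j 0 ^+ 2) / 2] in absolute value, and these averages sum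
    to the right-hand side. *)
Lemma quad_form_norm_le M v : (forall i j, `|M i j| <= 1) ->
  `|(v^T *m M *m v) 0 0| <= n%:R * dotv v v.
Proof.
move=> M1; rewrite quad_formE.
have -> : n%:R * dotv v v =
    \sum_(i < n) \sum_(j < n) (v i 0 ^+ 2 + v j 0 ^+ 2) / 2.
  transitivity (\sum_(i < n) (n%:R * v i 0 ^+ 2 + dotv v v) / 2).
    rewrite -mulr_suml big_split /= -mulr_sumr -dotvE sumr_const card_ord.
    by rewrite -[dotv v v *+ n]mulr_natl; field.
  apply: eq_bigr => i _; rewrite -mulr_suml big_split /= -dotvE.
  by rewrite sumr_const card_ord mulr_natl.
apply: (le_trans (ler_norm_sum _ _ _)); apply: ler_sum => i _.
apply: (le_trans (ler_norm_sum _ _ _)); apply: ler_sum => j _.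
rewrite !normrM -(real_normK (num_real (v i 0))).
rewrite -(real_normK (num_real (v j 0))).
have := sqr_ge0 (`|v i 0| - `|v j 0|).
have : `|v i 0| * `|M i j| * `|v j 0| <= `|v i 0| * `|v j 0|.
  by rewrite ler_wpM2r // ler_piMr.
nra.
Qed.

End QuadraticForms.

(** * Frobenius inner product, eigenvalue and entropy bounds *)

Section SymmetricMatrices.
Variables (R : realType) (n : nat).
Implicit Types X Y : symmx R n.

Lemma symmx_valD X Y : symmx_val (X + Y) = symmx_val X + symmx_val Y.
Proof. exact: (raddfD val). Qed.

Lemma symmx_valB X Y : symmx_val (X - Y) = symmx_val X - symmx_val Y.
Proof. exact: (raddfB val). Qed.

Lemma symmx_valZ (a : R) X : symmx_val (a *: X) = a *: symmx_val X.
Proof. exact: GRing.valZ. Qed.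

Lemma symmxC X i j : X i j = X j i.
Proof. by have /eqP/matrixP/(_ j i) := valP X; rewrite mxE. Qed.

Lemma symmx_innerE X Y : symmx_inner X Y = \sum_i \sum_j X i j * Y i j.
Proof.
rewrite /symmx_inner /mxtrace; apply: eq_bigr => i _; rewrite mxE.
by apply: eq_bigr => j _; rewrite (symmxC Y).
Qed.

Lemma symmx_innerDl X Y Z :
  symmx_inner (X + Y) Z = symmx_inner X Z + symmx_inner Y Z.
Proof. by rewrite /symmx_inner symmx_valD mulmxDl raddfD. Qed.

Lemma symmx_innerBr X Y Z :
  symmx_inner X (Y - Z) = symmx_inner X Y - symmx_inner X Z.
Proof. by rewrite /symmx_inner symmx_valB mulmxBr raddfB. Qed.

Lemma symmx_innerZl (a : R) X Y :
  symmx_inner (a *: X) Y = a * symmx_inner X Y.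
Proof. by rewrite /symmx_inner symmx_valZ -scalemxAl linearZ. Qed.

Lemma symmx_inner_ge0 X : 0 <= symmx_inner X X.
Proof.
rewrite symmx_innerE; apply: sumr_ge0 => i _; apply: sumr_ge0 => j _.
by rewrite -expr2 sqr_ge0.
Qed.

Lemma entry_le_frobenius X i j : `|X i j| <= Num.sqrt (symmx_inner X X).
Proof.
rewrite -sqrtr_sqr ler_sqrt ?symmx_inner_ge0 //.
rewrite symmx_innerE (bigD1 i) //= (bigD1 j) //= -expr2 -addrA lerDl.
apply: addr_ge0; last apply: sumr_ge0 => k _.
  by apply: sumr_ge0 => k _; rewrite -expr2 sqr_ge0.
by apply: sumr_ge0 => l _; rewrite -expr2 sqr_ge0.
Qed.

Lemma symmx_inner_eq0 X : symmx_inner X X = 0 -> X = 0.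
Proof.
move=> X0; apply/val_inj/matrixP => i j; rewrite (raddf0 val) mxE.
by have := entry_le_frobenius X i j; rewrite X0 sqrtr0 normr_le0 => /eqP.
Qed.

Lemma symmx_inner_le X Y (a c : R) :
  (forall i j, `|X i j| <= a) -> (forall i j, `|Y i j| <= c) ->
  symmx_inner X Y <= n%:R * (n%:R * (a * c)).
Proof.
move=> Xa Yc; rewrite symmx_innerE.
apply: (le_trans (y := \sum_(i < n) \sum_(j < n) a * c)); last first.
  by rewrite !sumr_const !card_ord !mulr_natl.
apply: ler_sum => i _; apply: ler_sum => j _.
by apply: (le_trans (ler_norm _)); rewrite normrM ler_pM.
Qed.

(** Take a left eigenvector [v] and compare both sides of [v *m M = s *: v] at a coordinate [j]
    where [v] has largest modulus. *)
Lemma eigenvalue_norm_le (M : 'M[R]_n) (K s : R) :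
  (forall i j, `|M i j| <= K) -> eigenvalue M s -> `|s| <= n%:R * K.
Proof.
move=> MK /eigenvalueP[v vM v0].
have [j0 vj0] : exists j, v 0 j != 0.
  apply/existsP; rewrite -negb_forall; apply: contra v0 => /forallP v0.
  by apply/eqP/rowP => j; rewrite mxE; apply/eqP; rewrite v0.
pose j := [arg max_(j > j0) `|v 0 j|]%O.
have jmax k : `|v 0 k| <= `|v 0 j|.
  by rewrite /j; case: arg_maxP => // i _ /(_ k isT).
have vj : 0 < `|v 0 j| by apply: lt_le_trans (jmax j0); rewrite normr_gt0.
rewrite -(ler_pM2r vj) -normrM.
have /rowP/(_ j) := vM; rewrite !mxE => <-.
apply: (le_trans (ler_norm_sum _ _ _)).
apply: (le_trans (y := \sum_(k < n) `|v 0 j| * K)).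
  by apply: ler_sum => k _; rewrite normrM ler_pM.
by rewrite sumr_const card_ord -[leLHS]mulr_natl (mulrC `|_|) mulrA.
Qed.

(* Holds for x <= 0 too, where the total function [ln] is 0. *)
Lemma xlnx_le_sqr (x : R) : x * ln x <= x ^+ 2.
Proof.
have [x0|x0] := ltP 0 x; last by rewrite ln0 // mulr0 sqr_ge0.
by rewrite expr2 ler_pM2l // ltW // ln_sublinear.
Qed.

(** An upper bound suffices, since the infimum is estimated from above at a test point. Squares of
    eigenvalues dominate the entropy, and the entries control the eigenvalues. *)
Lemma tr_xlnx_le X (K : R) :
  (forall i j, `|X i j| <= K) -> tr_xlnx X <= n%:R * (n%:R * K) ^+ 2.
Proof.
move=> XK; rewrite /tr_xlnx.
apply: (le_trans (y := \sum_(i < n) (n%:R * K) ^+ 2)); last first.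
  by rewrite sumr_const card_ord -[leLHS]mulr_natl.
apply: ler_sum => i _; apply: (le_trans (xlnx_le_sqr _)).
set s := symmx_eigenvalues X 0 i.
have sK : `|s| <= n%:R * K.
  apply: (@eigenvalue_norm_le X) => //.
  rewrite eigenvalue_root_char symmx_eigenvaluesP /root (bigD1 i) //=.
  by rewrite hornerM hornerXsubC subrr mul0r.
rewrite -(real_normK (num_real s)) lerXn2r // nnegrE //.
exact: le_trans (normr_ge0 s) sK.
Qed.

End SymmetricMatrices.

(** * Growth of the adjoint, perturbation of the Slater point, and divergence *)

Lemma adjoint_coercive (R : realType) (n m : nat)
  (A : {linear symmx R n -> 'cV[R]_m}) (Aadj : {linear 'cV[R]_m -> symmx R n}) :
  is_adjoint A Aadj -> (forall l, Aadj l = 0 -> l = 0) ->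
  exists2 c : R, 0 < c &
    forall l, c * enorm l <= Num.sqrt (symmx_inner (Aadj l) (Aadj l)).
Proof.
move=> A_adj Aadj_inj.
(* The Gram form l |-> <A* l, A* l> is positive definite;
   M is the matrix of A o A*. *)
pose M : 'M[R]_m := \matrix_(i, j) A (Aadj (delta_mx j 0)) i 0.
have ME l : M *m l = A (Aadj l).
  rewrite {2}[l]matrix_sum_delta !raddf_sum /=.
  apply/colP => i; rewrite mxE summxE; apply: eq_bigr => j _.
  by rewrite big_ord1 !linearZ !mxE mulrC.
(* The transpose enters because [l^T *m M^T] is [(M *m l)^T], to which the adjoint identity
   applies. *)
have qE l : (l^T *m M^T *m l) 0 0 = symmx_inner (Aadj l) (Aadj l).
  by rewrite -trmx_mul ME -A_adj.
have [l l0|c c0 cM] := @posdef_coercive R m M^T.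
  rewrite qE lt_def symmx_inner_ge0 andbT; apply: contra l0 => /eqP.
  by move/symmx_inner_eq0/Aadj_inj ->.
exists (Num.sqrt c); first by rewrite sqrtr_gt0.
by move=> l; rewrite -sqrtrM ?(ltW c0) // ler_sqrt ?symmx_inner_ge0 // -qE.
Qed.

(** The form of [X] is at least [c * dotv v v], while that of [Y] is at least [- (n%:R * dotv v v)],
    so any [t] with [t * n%:R <= c] works. *)
Lemma posdef_psd_ball (R : realType) (n : nat) (X : symmx R n) : posdef X ->
  exists2 t : R, 0 < t &
    forall Y : symmx R n, (forall i j, `|Y i j| <= 1) -> psd (X + t *: Y).
Proof.
move=> /posdef_coercive[c c0 cX].
(* Dividing by [n.+1] rather than [n] keeps [t] positive when [n] is 0. *)
exists (c / n.+1%:R); first by rewrite divr_gt0.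
move=> Y Y1 v; rewrite symmx_valD symmx_valZ mulmxDr mulmxDl mxE.
rewrite -scalemxAr -scalemxAl [X in _ + X]mxE.
have := quad_form_norm_le v Y1; rewrite ler_norml => /andP[vY _].
have d0 := dotv_ge0 v.
have : c / n.+1%:R * - (n%:R * dotv v v) <=
       c / n.+1%:R * (v^T *m Y *m v) 0 0.
  by rewrite ler_wpM2l // divr_ge0 // ltW.
have : c / n.+1%:R * (n%:R * dotv v v) <= c * dotv v v.
  rewrite mulrA ler_wpM2r // mulrAC ler_pdivrMr // ler_pM2l // ler_nat.
  exact: leqnSn.
have := cX v; set t := c / _; rewrite mulrN; lra.
Qed.

Lemma dual_entropic_le (R : realType) (n m : nat) (C : symmx R n)
  (b : 'cV[R]_m) (eps : R) (A : symmx R n -> 'cV[R]_m)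
  (Aadj : 'cV[R]_m -> symmx R n) (X0 : symmx R n) :
  0 < eps -> is_adjoint A Aadj -> feasible A b X0 -> posdef X0 ->
  exists2 t : R, 0 < t & exists K, forall l,
    (dual_entropic C b Aadj eps l <=
     (K - t * Num.sqrt (symmx_inner (Aadj l) (Aadj l)))%:E)%E.
Proof.
move=> eps0 A_adj [AX0 _] /posdef_psd_ball[t t0 tX0].
(* [a] bounds the entries of the test point [X] uniformly in [l]: those of [X0] by its Frobenius
   norm, those of [t *: Y] by [t]. *)
exists t => //; pose a := Num.sqrt (symmx_inner X0 X0) + t.
pose c := Num.sqrt (symmx_inner C C).
(* The first summand bounds the inner product of [X] and [C], the second the entropy term. *)
exists (n%:R * (n%:R * (a * c)) + eps * (n%:R * (n%:R * a) ^+ 2)) => l.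
(* If L = 0 then N^-1 = 0, and the argument below goes through with X = X0. *)
set L := Aadj l; set N := Num.sqrt (symmx_inner L L).
have N0 : 0 <= N by exact: sqrtr_ge0.
have NN : symmx_inner L L = N ^+ 2 by rewrite sqr_sqrtr // symmx_inner_ge0.
pose Y := N^-1 *: L.
have Y1 i j : `|Y i j| <= 1.
  rewrite /Y symmx_valZ mxE normrM normfV (ger0_norm N0).
  have := entry_le_frobenius L i j; rewrite -/N => LN.
  have [->|N1] := eqVneq N 0; first by rewrite invr0 mul0r.
  by rewrite ler_pdivrMl ?mulr1 // lt_def N1.
pose X := X0 + t *: Y.
have Xa i j : `|X i j| <= a.
  rewrite /X symmx_valD symmx_valZ mxE [X in _ + X]mxE.
  apply: (le_trans (ler_normD _ _)).
  apply: lerD; first exact: entry_le_frobenius.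
  by rewrite normrM gtr0_norm // ler_piMr // ltW.
have bl : dotv b l = symmx_inner X0 L by rewrite -AX0 A_adj.
have XL : symmx_inner X L = symmx_inner X0 L + t * N.
  rewrite symmx_innerDl !symmx_innerZl NN.
  have [->|N1] := eqVneq N 0; first by rewrite invr0 mul0r.
  by rewrite expr2 mulKf.
apply: (le_trans (y := ((dotv b l)%:E +
    (symmx_inner X (C - L) + eps * tr_xlnx X)%:E)%E)).
  by rewrite leeD2l //; apply: ereal_inf_lbound; exists X => //; exact: tX0.
rewrite -EFinD lee_fin symmx_innerBr XL bl.
have := symmx_inner_le Xa (entry_le_frobenius C).
have : eps * tr_xlnx X <= eps * (n%:R * (n%:R * a) ^+ 2).
  by rewrite ler_pM2l //; exact: tr_xlnx_le.
rewrite -/c; lra.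
Qed.

(** Quantifying over all filters along which the norm diverges covers both sequences and the
    complements of balls. *)
Theorem lemma2p7 (R : realType) (n m : nat) (C : symmx R n) (b : 'cV[R]_m)
  (eps : R) (A : {linear symmx R n -> 'cV[R]_m})
  (Aadj : {linear 'cV[R]_m -> symmx R n})
  (eps_gt0 : 0 < eps)
  (A_adj : is_adjoint A Aadj)
  (Omega_compact : compact (feasible A b))
  (slater : exists2 X0, feasible A b X0 & posdef X0)
  (Aadj_inj : forall l : 'cV[R]_m, Aadj l = 0 -> l = 0) :
  forall F : set_system 'cV[R]_m, Filter F ->
  enorm l @[l --> F] --> +oo ->
  dual_entropic C b Aadj eps l @[l --> F] --> -oo%E.
Proof.
move=> F FF /cvgryPge l_oo; case: slater => X0 X0_feas X0_pd.
have [c c0 cN] := adjoint_coercive A_adj Aadj_inj.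
have [t t0 [K G_le]] := dual_entropic_le C eps_gt0 A_adj X0_feas X0_pd.
apply/cvgeNyPle => B.
(* Beyond this threshold [K - t * (c * enorm l) <= B]. *)
apply: filterS (l_oo ((K - B) / (t * c))) => l.
rewrite ler_pdivrMr ?mulr_gt0 // => lB.
apply: (le_trans (G_le l)); rewrite lee_fin.
have : t * (c * enorm l) <= t * Num.sqrt (symmx_inner (Aadj l) (Aadj l)).
  by rewrite ler_pM2l.
nra.
Qed.
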